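(* Define integers $s_n(i,j),t_n(i,j)$ ($n\ge1$, $i,j\in\mathbb Z$) by $t_1(0,1)=1$, $t_1(i,j)=0$ for $(i,j)\ne(0,1)$, and for $n\ge1$ $$s_n(i,j)=i\,t_n(i,j-1)+j\,t_n(i-1,j)+2(3n+2-i-2j)t_n(i-1,j-1),$$ $$t_{n+1}(i,j)=(i+1)s_n(i+1,j-1)+j\,s_n(i,j)+2(3n+3-i-2j)s_n(i,j-1).$$ Then for $n\ge1$, $$s_n(i,j)=\#\{\pi\in\mathrm{JSP}_n:\mathrm{ubdes}(\pi)=i,\ \mathrm{expk}(\pi)=j,\ \mathrm{bddes}(\pi)=0,\ \mathrm{desp}(\pi)=0\},$$ $$t_n(i,j)=\#\{\pi\in\mathrm{JSPD}_n:\mathrm{ubdes}(\pi)=i,\ \mathrm{expk}(\pi)=j,\ \mathrm{bddes}(\pi)=0,\ \mathrm{desp}(\pi)=0\}.$$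
   Context: $M_n=\{\overline1,1,1,\overline2,2,2,\dots,\overline n,n,n\}$ with total order $\overline1<1<\overline2<2<\cdots<\overline n<n$. For a sub-multiset $M$ of $M_n$, a Jacobi-Stirling permutation of $M$ is a permutation of $M$ such that for each $i$ whose two unbarred copies lie in $M$, all entries between them are larger than $i$. $\mathrm{JSP}_n$ is the set of Jacobi-Stirling permutations of $M_n$ and $\mathrm{JSPD}_n$ that of $M_n\setminus\{n,n\}$. For such $\pi=\pi_1\cdots\pi_m$ set $\pi_0=\pi_{m+1}=0$; all statistics below range over indices $i\in[m]$: $\mathrm{ubdes}(\pi)=\#\{i:\pi_i>\pi_{i+1},\ \pi_i\text{ unbarred}\}$; $\mathrm{expk}(\pi)=\#\{i:\pi_{i-1}<\pi_i>\pi_{i+1}\text{ or }\pi_{i-1}<\pi_i=\pi_{i+1}\}$; $\mathrm{bddes}(\pi)=\#\{i:\pi_{i-1}>\pi_i>\pi_{i+1},\ \pi_i\text{ barred}\}$; $\mathrm{desp}(\pi)=\#\{i:\pi_{i-1}>\pi_i=\pi_{i+1}\}$. *)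

(* Defs.v *)
From mathcomp Require Import all_boot all_order all_algebra.

Set Implicit Arguments.
Unset Strict Implicit.
Unset Printing Implicit Defensive.

(* Letters are coded by positive integers so that the order of [nat] is
   1bar < 1 < 2bar < 2 < ...: odd codes are barred, and 0 is left for the
   boundary convention pi_0 = pi_(m+1) = 0. *)
Definition bar (i : nat) : nat := i.*2.-1.
Definition unb (i : nat) : nat := i.*2.

Definition barred (x : nat) : bool := odd x.
Definition unbarred (x : nat) : bool := ~~ odd x.

Definition M (n : nat) : seq nat :=
  flatten [seq [:: bar i; unb i; unb i] | i <- iota 1 n].

Definition MD (n : nat) : seq nat := rem (unb n) (rem (unb n) (M n)).

(* pi_k with 1-based k; it is 0 for k = 0 and for k > size p. *)
Definition ent (p : seq nat) (k : nat) : nat := nth 0 (0 :: p) k.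

(* An unbarred letter occurs at most twice in a sub-multiset of [M n], so two
   positions a < c holding it are exactly its two copies. *)
Definition jacobi_stirling (p : seq nat) : bool :=
  all (fun c => all (fun a =>
      unbarred (ent p a) && (ent p a == ent p c) ==>
      all (fun b => ent p a < ent p b) (index_iota a.+1 c))
    (index_iota 1 c)) (iota 1 (size p)).

(* [permutations] is duplicate-free: equal letters are not distinguished. *)
Definition JS_perms (s : seq nat) : seq (seq nat) :=
  [seq p <- permutations s | jacobi_stirling p].

Definition JSP (n : nat) : seq (seq nat) := JS_perms (M n).
Definition JSPD (n : nat) : seq (seq nat) := JS_perms (MD n).

Definition ubdes (p : seq nat) : nat :=
  count (fun i => (ent p i > ent p i.+1) && unbarred (ent p i))
    (iota 1 (size p)).

Definition expk (p : seq nat) : nat :=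
  count (fun i => (ent p i.-1 < ent p i) && (ent p i > ent p i.+1) ||
                  (ent p i.-1 < ent p i) && (ent p i == ent p i.+1))
    (iota 1 (size p)).

Definition bddes (p : seq nat) : nat :=
  count (fun i => [&& ent p i.-1 > ent p i, ent p i > ent p i.+1
                    & barred (ent p i)])
    (iota 1 (size p)).

Definition desp (p : seq nat) : nat :=
  count (fun i => (ent p i.-1 > ent p i) && (ent p i == ent p i.+1))
    (iota 1 (size p)).

(* Main.v *)
Require Import Defs.
From mathcomp Require Import all_boot all_order all_algebra.
From mathcomp Require Import ring zify.
Import GRing.Theory.

(** Build the words by inserting the largest letter N (as N or NN) in each of
    the m+1 gaps of a word of length m.  Call a gap of type U if it follows an
    unbarred descent top, L or R if it is one of the two gaps adjacent to (or
    for a plateau: before and inside) a letter counted by expk, and D if it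
    follows a letter counted by bddes or lies inside a plateau counted by desp.
    These types are exclusive, and insertion changes
    (ubdes, expk, bddes + desp) by ([NN inserted] - U, 1 - L - R, L - D).  So
    the joint distribution satisfies a recurrence whose solution is
    f(i, j) * binomial(m + 1 - i - 2j, l), where l is the value of bddes + desp
    and f obeys the recurrence of the theorem; the factor 2 arises as the sum
    of the contributions of D gaps and of gaps without a type.  Now take
    l = 0. *)

(** * Jacobi-Stirling words as pattern-avoiding words *)

Local Open Scope nat_scope.

(** The subsequence form is inherited by subwords. The case [y = x] forbids a third copy of [x], as
    [jacobi_stirling] also does by testing every pair of equal unbarred entries. *)
Definition avoids (p : seq nat) : Prop :=
  forall x y, unbarred x -> y <= x -> ~~ subseq [:: x; y; x] p.

Lemma subseq_consP (x : nat) (s p : seq nat) :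
  reflect (exists a, [/\ a < size p, nth 0 p a = x & subseq s (drop a.+1 p)])
          (subseq (x :: s) p).
Proof.
apply: (iffP idP) => [|[a [lt_a <- sub_s]]].
  elim: p => [//|y p IHp] /=; case: eqP => [<- sub_s|_ /IHp[a [lt_a px sub_s]]].
    by exists 0; split; rewrite ?drop0.
  by exists a.+1.
rewrite -[X in subseq _ X](cat_take_drop a) (drop_nth 0 lt_a).
by apply: subseq_trans (suffix_subseq _ _); rewrite /= eqxx.
Qed.

Lemma jacobi_stirlingP (p : seq nat) : reflect (avoids p) (jacobi_stirling p).
Proof.
apply: (iffP idP) => [/allP JS x y ubx le_yx | av].
  apply/negP => /subseq_consP[a [lt_a px]] /subseq_consP[b [lt_b py]].
  case/subseq_consP=> c [lt_c pz _].
  rewrite !size_drop in lt_b lt_c; rewrite !nth_drop in py pz.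
  (* Each position is relative to the suffix after the previous letter, and [ent] counts from 1. *)
  have /JS/allP/(_ a.+1) : (a.+1 + (b.+1 + c)).+1 \in iota 1 (size p).
    by rewrite mem_iota; lia.
  rewrite mem_index_iota /ent /= px pz ubx eqxx /= => /(_ ltac:(lia)).
  move=> /allP/(_ (a.+1 + b).+1); rewrite mem_index_iota /= py.
  by move=> /(_ ltac:(lia)); lia.
apply/allP => -[|c]; rewrite mem_iota //= => lt_c.
apply/allP => -[|a]; rewrite mem_index_iota //= => lt_a.
apply/implyP => /andP[ubx /eqP eq_ac].
apply/allP => -[|b]; rewrite mem_index_iota //= => lt_b.
rewrite ltnNge; apply/negP => /(av _ _ ubx)/negP; apply.
rewrite {2}eq_ac /ent /=; apply/subseq_consP; exists a; split=> //; first lia.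
apply/subseq_consP; exists (b - a.+1); rewrite nth_drop size_drop.
split; [lia | by congr nth; lia | rewrite sub1seq drop_drop].
have ->: c = (b - a.+1).+1 + a.+1 + (c - b.+1) by lia.
rewrite -nth_drop mem_nth // size_drop.
move: (size p) lt_c lt_b => m lt_c /andP[lt_ab lt_bc]. lia.
Qed.

(** * Inserting and deleting the largest letter *)

Definition ins (B : seq nat) (k : nat) (p : seq nat) : seq nat :=
  take k p ++ B ++ drop k p.

Lemma JS_permsP (s p : seq nat) :
  reflect (avoids p /\ perm_eq p s) (p \in JS_perms s).
Proof.
rewrite mem_filter mem_permutations.
by apply: (iffP andP) => -[/jacobi_stirlingP].
Qed.

Lemma avoids_subseq (p q : seq nat) : subseq p q -> avoids q -> avoids p.
Proof.
move=> sub_pq av x y ubx le_yx; apply: contra (av x y ubx le_yx).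
by move/subseq_trans; apply.
Qed.

Lemma filter_ins (N m k : nat) (p : seq nat) :
  N \notin p -> filter (predC1 N) (ins (nseq m N) k p) = p.
Proof.
move=> Np; rewrite !filter_cat filter_nseq /= eqxx /= -filter_cat cat_take_drop.
by apply/all_filterP/allP => x px; apply: contraNneq Np => <-.
Qed.

Lemma index_ins (N m k : nat) (p : seq nat) :
  N \notin p -> k <= size p -> index N (ins (nseq m.+1 N) k p) = k.
Proof.
move=> Np le_k; rewrite index_cat ifN /=.
  by rewrite eqxx addn0 size_takel.
by apply: contra Np; apply: mem_take.
Qed.

Lemma perm_ins (B : seq nat) (k : nat) (p : seq nat) :
  perm_eq (ins B k p) (B ++ p).
Proof. by rewrite /ins perm_catCA perm_cat2l cat_take_drop. Qed.

Lemma subseq_cons_cat (N : nat) (s l r : seq nat) :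
  N \notin l -> subseq (N :: s) (l ++ N :: r) = subseq s r.
Proof.
elim: l => [_|x l IHl] /=; first by rewrite eqxx.
by rewrite inE negb_or => /andP[/negPf-> /IHl].
Qed.

(** A forbidden pattern on [x < N] has [y < N] too, so it survives the deletion of [N] and already
    occurs in [p]. For [x = N] the letter is unbarred and its only two copies are adjacent, with
    nothing between them. *)
Lemma avoids_ins (N : nat) (b : bool) (k : nat) (p : seq nat) :
  all (ltn^~ N) p -> odd N = ~~ b -> avoids p ->
  avoids (ins (nseq b.+1 N) k p).
Proof.
move=> /allP ltN oddN av x y ubx le_yx; apply/negP => sub_q.
have Np : N \notin p by apply/negP => /ltN; rewrite /= ltnn.
have leN z : z \in ins (nseq b.+1 N) k p -> z <= N.
  rewrite (perm_mem (perm_ins _ _ _)) mem_cat mem_nseq /=.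
  by case/orP => [/eqP-> //|/ltN/ltnW].
have [xN | xN] := eqVneq x N; last first.
  have yN : y != N.
    have /leN := mem_subseq sub_q (mem_head x _).
    by move: xN le_yx; lia.
  case/negP: (av x y ubx le_yx).
  by rewrite -(filter_ins N b.+1 k p Np) subseq_filter /= xN yN.
move: ubx; rewrite /unbarred xN oddN negbK => bT.
rewrite {x}xN bT in le_yx sub_q.
have Nt : N \notin take k p by apply: contra Np => /mem_take.
have Nd : N \notin drop k p by apply: contra Np => /mem_drop.
move: sub_q; rewrite /ins /= subseq_cons_cat //=.
have [_ | neq_yN] := eqVneq y N; first by rewrite sub1seq (negPf Nd).
by move=> sub_d; rewrite (mem_subseq sub_d) ?mem_head ?inE ?eqxx ?orbT in Nd.
Qed.

(** No letter exceeds [N], so any letter between two copies of an unbarred [N] would create a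
    forbidden pattern; hence the copies form one block. *)
Lemma ins_avoids (N : nat) (b : bool) (s q : seq nat) :
  all (ltn^~ N) s -> odd N = ~~ b -> avoids q -> perm_eq q (nseq b.+1 N ++ s) ->
  exists2 k, k <= size s & q = ins (nseq b.+1 N) k (filter (predC1 N) q).
Proof.
move=> /allP ltN oddN av eq_q.
have Ns : N \notin s by apply/negP => /ltN; rewrite /= ltnn.
have cntN : count_mem N q = b.+1.
  rewrite (permP eq_q) count_cat count_nseq /= eqxx mul1n.
  by rewrite (count_memPn Ns) addn0.
have leN z : z \in q -> z <= N.
  rewrite (perm_mem eq_q) mem_cat mem_nseq /=.
  by case/orP => [/eqP-> //|/ltN/ltnW].
suff [l [r def_q]] : exists l r, q = l ++ nseq b.+1 N ++ r.
  have [Nl Nr] : N \notin l /\ N \notin r.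
    move: cntN; rewrite def_q !count_cat count_nseq /= eqxx mul1n => cnt.
    have [? ?] : count_mem N l = 0 /\ count_mem N r = 0.
      by move: (count_mem N l) (count_mem N r) cnt => u v; lia.
    by split; apply/count_memPn.
  have fid t : N \notin t -> filter (predC1 N) t = t.
    by move=> Nt; apply/all_filterP/allP => x xt; apply: contraNneq Nt => <-.
  exists (size l).
    move/perm_size: eq_q; rewrite def_q !size_cat !size_nseq.
    by move: (size l) (size r) (size s) => u v w; lia.
  rewrite def_q !filter_cat filter_nseq /= eqxx /= !fid //.
  by rewrite /ins take_size_cat // drop_size_cat.
have Nq : N \in q by rewrite -has_pred1 has_count cntN.
pose l := take (index N q) q; pose r := drop (index N q).+1 q.
have def_q : q = l ++ N :: r by rewrite -drop_index ?cat_take_drop.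
have Nl : N \notin l by rewrite in_take // ltnn.
exists l; case: b oddN cntN {eq_q} => oddN cntN; last by exists r.
move: cntN; rewrite def_q count_cat (count_memPn Nl) /= eqxx.
(* If the letter [y] after the first [N] were not [N], the second copy would lie further right and
   [N y N] would occur. *)
case def_r: r => [|y r'] //= cntN; exists r'.
have [yN | neq_yN] := eqVneq y N; first by rewrite yN.
have le_yN : y <= N by apply: leN; rewrite def_q def_r mem_cat !inE eqxx !orbT.
have ubN : unbarred N by rewrite /unbarred oddN.
have /negP[] := av N y ubN le_yN; rewrite def_q def_r.
rewrite subseq_cons_cat //= eqxx sub1seq -has_pred1 has_count.
by move: cntN; rewrite (negPf neq_yN); case: (count_mem N r').
Qed.

Lemma JS_perms_eq (s1 s2 : seq nat) :
  perm_eq s1 s2 -> perm_eq (JS_perms s1) (JS_perms s2).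
Proof.
move=> eq_s; apply: uniq_perm; rewrite ?filter_uniq ?permutations_uniq // => p.
by rewrite !mem_filter !mem_permutations (permPr eq_s).
Qed.

(** The inverse of the insertion deletes [N] to recover the word, and reads the gap off as the index
    of the first [N]. *)
Lemma JS_perms_ins (N : nat) (b : bool) (s : seq nat) :
  all (ltn^~ N) s -> odd N = ~~ b ->
  perm_eq (JS_perms (nseq b.+1 N ++ s))
    [seq ins (nseq b.+1 N) k p | p <- JS_perms s, k <- iota 0 (size s).+1].
Proof.
move=> ltN oddN.
have ltp p : p \in JS_perms s -> all (ltn^~ N) p.
  by case/JS_permsP=> _ eq_p; rewrite (perm_all _ eq_p).
have Np p : p \in JS_perms s -> N \notin p.
  by move/ltp/allP=> lt; apply/negP => /lt; rewrite /= ltnn.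
have szp p : p \in JS_perms s -> size p = size s.
  by case/JS_permsP => _ /perm_size.
apply: uniq_perm; first by rewrite filter_uniq ?permutations_uniq.
  apply: allpairs_uniq; rewrite ?iota_uniq ?filter_uniq ?permutations_uniq //.
  move=> x x' /allpairsP[[u v] [us ltv ->]] /allpairsP[[u' v'] [us' ltv' ->]].
  rewrite !mem_iota /= in us us' ltv ltv' * => eq_ins.
  have {eq_ins}: ins (nseq b.+1 N) v u = ins (nseq b.+1 N) v' u' by [].
  move=> eq_ins.
  have [Nu Nu' su su'] := And4 (Np _ us) (Np _ us') (szp _ us) (szp _ us').
  have := congr1 (filter (predC1 N)) eq_ins; rewrite !filter_ins // => eq_u.
  have := congr1 (index N) eq_ins.
  by rewrite !index_ins ?eq_u ?su ?su' // => ->.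
move=> q; apply/JS_permsP/allpairsP => [[av eq_q] | [[p k] /= [ps _ ->]]].
  have [k le_k def_q] := ins_avoids _ _ _ _ ltN oddN av eq_q.
  exists (filter (predC1 N) q, k); rewrite mem_iota; split=> //=.
  apply/JS_permsP; split; first exact: avoids_subseq (filter_subseq _ _) av.
  have:= perm_filter (predC1 N) eq_q.
  rewrite filter_cat filter_nseq /= eqxx /= => /perm_trans; apply.
  rewrite (all_filterP _) //; apply/allP => x /(allP ltN) /=.
  by rewrite neq_ltn => ->.
split; last first.
  apply: perm_trans (perm_ins _ _ _) _; rewrite perm_cat2l.
  by case/JS_permsP: ps.
apply: avoids_ins => //; first exact: ltp.
by case/JS_permsP: ps.
Qed.

(** * Statistics as sums over consecutive triples *)

(** The middle entry runs over the letters of [s]. The argument [a] stands before the first letter,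
    and the default 0 of [head] is the boundary value after the last one. *)
Fixpoint tri (Q : nat -> nat -> nat -> bool) (a : nat) (s : seq nat) : nat :=
  if s is x :: s' then Q a x (head 0 s') + tri Q x s' else 0.

Lemma sum_tri (Q : nat -> nat -> nat -> bool) (a : nat) (s : seq nat) :
  \sum_(0 <= k < size s) Q (nth 0 (a :: s) k) (nth 0 s k) (nth 0 s k.+1) =
  tri Q a s.
Proof.
elim: s a => [|x s IHs] a; first by rewrite big_nil.
by rewrite big_nat_recl //= nth0 IHs.
Qed.

Lemma count_tri (Q : nat -> nat -> nat -> bool) (p : seq nat) :
  count (fun i => Q (ent p i.-1) (ent p i) (ent p i.+1)) (iota 1 (size p)) =
  tri Q 0 p.
Proof.
rewrite -sum_tri /index_iota subn0 -sum1_count (iotaDl 1 0) big_map.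
by rewrite big_mkcond; apply: eq_bigr => i _; case: (Q _ _ _).
Qed.

(** Gap [k] is assigned to the letter on its left, which for [k = 0] is the boundary 0; hence the
    condition on [Q]. In [sum_gaps_right] the boundary letter occurs at the last gap. *)
Lemma sum_gaps_left (Q : nat -> nat -> nat -> bool) (s : seq nat) :
  (forall a c, Q a 0 c = false) ->
  \sum_(0 <= k < (size s).+1)
    Q (nth 0 [:: 0, 0 & s] k) (nth 0 (0 :: s) k) (nth 0 s k) = tri Q 0 s.
Proof. by move=> Q0; rewrite big_nat_recl //= Q0 sum_tri. Qed.

Lemma sum_gaps_right (Q : nat -> nat -> nat -> bool) (s : seq nat) :
  (forall a c, Q a 0 c = false) ->
  \sum_(0 <= k < (size s).+1)
    Q (nth 0 (0 :: s) k) (nth 0 s k) (nth 0 s k.+1) = tri Q 0 s.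
Proof.
move=> Q0; rewrite big_nat_recr //= [nth 0 s (size s)]nth_default //.
by rewrite Q0 sum_tri addn0.
Qed.

(** Only the triples centred at the neighbours [y] and [z] of the gap change, and those centred at
    the new letters are added. Old and new triples are put on opposite sides to avoid subtraction in
    [nat]. *)
Lemma tri_ins (Q : nat -> nat -> nat -> bool) (N : nat) (b : bool) (k : nat)
    (p : seq nat) :
  (forall a c, Q a 0 c = false) -> k <= size p ->
  let y' := nth 0 [:: 0, 0 & p] k in let y := nth 0 (0 :: p) k in
  let z := nth 0 p k in let z' := nth 0 p k.+1 in
  tri Q 0 (ins (nseq b.+1 N) k p) + Q y' y z + Q y z z' =
  tri Q 0 p + Q y' y N + Q N z z' +
  (if b then Q y N N + Q N N z else Q y N z).
Proof.
(* For the induction, two arbitrary letters [a], [x] precede the word, and the triple centred at [x]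
   is carried along since an insertion at gap 0 alters it. *)
move=> Q0; suff H s a x : k <= size s ->
  let y' := nth 0 [:: a, x & s] k in let y := nth 0 (x :: s) k in
  let z := nth 0 s k in let z' := nth 0 s k.+1 in
  let t := ins (nseq b.+1 N) k s in
  Q a x (head 0 t) + tri Q x t + Q y' y z + Q y z z' =
  Q a x (head 0 s) + tri Q x s + Q y' y N + Q N z z' +
  (if b then Q y N N + Q N N z else Q y N z).
  by move=> /(H p 0 0) /=; rewrite !Q0.
elim: k s a x => [|k IHk] [|y s] a x //= le_k.
- by rewrite /ins /=; case: b => /=; rewrite !Q0; lia.
- by rewrite /ins /= !nth0; case: b => /=; lia.
have /= := IHk s x y le_k; rewrite /ins /=; set t := tri Q y _.
by move: t (tri Q y s) => t u; lia.
Qed.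

(** * Effect of an insertion on the statistics *)

(* Both copies of each unbarred letter must be present: otherwise an unbarred
   letter could be a peak without a plateau. *)
Definition admissible (p : seq nat) : Prop :=
  avoids p /\ forall x, x \in p -> 0 < x /\ count_mem x p = (~~ odd x).+1.

(** If an unbarred [x] exceeded both neighbours, its other copy would lie on one side, and the
    smaller neighbour on that side would be between the two copies. The other two claims follow from
    the multiplicities. *)
Lemma admissible_local (p : seq nat) (j : nat) : admissible p -> j < size p ->
  let a := nth 0 (0 :: p) j in let x := nth 0 p j in let c := nth 0 p j.+1 in
  [/\ ~~ [&& ~~ odd x, a < x & c < x], (a == x) ==> ~~ odd x
    & ~~ ((a == x) && (x == c))].
Proof.
move=> [av mult] lt_j /=.
have [x0 cntx] := mult _ (mem_nth 0 lt_j).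
set x := nth 0 p j in x0 cntx *.
have def_p : p = take j p ++ x :: drop j.+1 p.
  by rewrite -drop_nth // cat_take_drop.
have sz_l : size (take j p) = j by rewrite size_takel 1?ltnW.
move: (take j p) (drop j.+1 p) sz_l def_p => l r sz_l def_p; clearbody x.
have -> : nth 0 (0 :: p) j = last 0 l.
  by rewrite def_p -cat_cons nth_cat /= -sz_l ltnSn (last_nth 0).
have {sz_l}-> : nth 0 p j.+1 = head 0 r.
  by rewrite def_p nth_cat sz_l ltnNge leqnSn /= subSn // subnn /= nth0.
have no_pattern y : ~~ odd x -> y <= x -> subseq [:: x; y; x] p -> False.
  by move=> ubx le_yx; apply/negP/av.
move: cntx; rewrite {1}def_p count_cat /= eqxx => cntx; split.
- apply/negP => /and3P[ubx lt_ax lt_cx].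
  have [xl | xl] := boolP (x \in l).
    case/lastP: l => [|l a] in def_p cntx lt_ax xl * => //.
    rewrite last_rcons in lt_ax.
    apply: (no_pattern a) => //; first exact: ltnW.
    rewrite def_p -cats1 -catA -[_ :: _]cat1s cat_subseq //=.
      move: xl; rewrite mem_rcons inE eqn_leq [x <= a]leqNgt lt_ax /=.
      by rewrite sub1seq.
    by rewrite !eqxx sub0seq.
  case: r => [|c r] in def_p cntx lt_cx *.
    by rewrite (count_memPn xl) ubx in cntx.
  apply: (no_pattern c) => //; first exact: ltnW.
  rewrite def_p; apply: subseq_trans (suffix_subseq _ _) => /=.
  rewrite !eqxx sub1seq -has_pred1 has_count.
  move: cntx; rewrite (count_memPn xl) ubx /=.
  rewrite eqn_leq [x <= c]leqNgt lt_cx andbF.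
  by case: (count_mem x r).
- apply/implyP => /eqP ax; case/lastP: l => [|l a] in def_p cntx ax *.
    by rewrite -ax in x0.
  move: cntx; rewrite last_rcons in ax; rewrite -cats1 count_cat /= ax eqxx.
  by case: (odd x) => //=; lia.
- apply/negP => /andP[/eqP ax /eqP xc].
  case/lastP: l => [|l a] in def_p cntx ax *; first by rewrite -ax in x0.
  rewrite last_rcons in ax; case: r => [|c r] in def_p cntx xc *.
    by rewrite xc in x0.
  rewrite /= in xc; move: cntx; rewrite -cats1 count_cat /= ax -xc eqxx.
  by case: (odd x) => /=; move: (count_mem x l) (count_mem x r) => u v; lia.
Qed.

(* [peak] is the condition of [expk], and [bad] joins those of [bddes] and
   [desp]; the test [0 < y] makes [bad] ignore the padding zeros. *)
Definition des_ub (_ y z : nat) : bool := (y > z) && ~~ odd y.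
Definition peak (a y z : nat) : bool := (a < y) && (z <= y).
Definition bad (a y z : nat) : bool :=
  [&& 0 < y, y < a & (z == y) || (z < y) && odd y].

Lemma ubdes_tri (p : seq nat) : ubdes p = tri des_ub 0 p.
Proof. by rewrite -count_tri. Qed.

Lemma expk_tri (p : seq nat) : expk p = tri peak 0 p.
Proof.
rewrite -count_tri; apply: eq_count => i.
by rewrite -andb_orr eq_sym orbC -leq_eqVlt.
Qed.

Lemma bddes_desp_tri (p : seq nat) :
  all (ltn 0) p -> bddes p + desp p = tri bad 0 p.
Proof.
rewrite /bddes /desp (count_tri (fun a x c => [&& a > x, x > c & barred x])).
rewrite (count_tri (fun a x c => (a > x) && (x == c))).
move: {-1}0 => a; elim: p a => [//|x p IHp] a /= /andP[x0 /(IHp x) <-].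
rewrite /bad /barred; move: (head 0 p) (odd x) => c o.
move: (tri _ x p) (tri _ x p) => u v; lia.
Qed.

(** The indicators [des_ub y' y z], [peak y' y z], [peak y z z'] and [bad y' y z] say that the gap
    has type U, R, L and D. In type L the former peak [z] now follows [N]; by [admissible_local] it
    is barred or starts a plateau, so it becomes [bad]. *)
Lemma stat_ins (N : nat) (b : bool) (k : nat) (p : seq nat) :
  0 < N -> all (ltn^~ N) p -> odd N = ~~ b -> admissible p -> k <= size p ->
  let y' := nth 0 [:: 0, 0 & p] k in let y := nth 0 (0 :: p) k in
  let z := nth 0 p k in let z' := nth 0 p k.+1 in
  let q := ins (nseq b.+1 N) k p in
  [/\ ubdes q + des_ub y' y z = ubdes p + b,
      expk q + peak y' y z + peak y z z' = expk p + 1,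
      bddes q + desp q + bad y' y z = bddes p + desp p + peak y z z' &
      des_ub y' y z + peak y' y z + peak y z z' + bad y' y z <= 1].
Proof.
move=> N0 ltN oddN adm le_k y' y z z' q.
have pos_p : all (ltn 0) p by apply/allP => x /(proj2 adm)[].
have pos_q : all (ltn 0) q.
  by rewrite (perm_all _ (perm_ins _ _ _)) all_cat all_nseq pos_p /= N0.
rewrite !bddes_desp_tri // !expk_tri !ubdes_tri.
have /= Hu := tri_ins des_ub N b k p (fun _ _ => erefl) le_k.
have /= He := tri_ins peak N b k p (fun _ _ => erefl) le_k.
have /= Hd := tri_ins bad N b k p (fun _ _ => erefl) le_k.
have ltN_nth i : nth 0 p i < N.
  have [/(mem_nth 0)/(allP ltN) // | le_i] := ltnP i (size p).
  by rewrite nth_default.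
have yN : y < N by rewrite /y; case: (k).
have zN : z < N by exact: ltN_nth.
have loc_y : ~~ [&& ~~ odd y, y' < y & z < y].
  rewrite /y /y' /z; case: (k) le_k => [|j] lt_j; first by [].
  by have [] := admissible_local _ _ adm lt_j.
(* At the last gap [z] is the default 0, not a letter. *)
have loc_z : 0 < z ->
  [/\ ~~ [&& ~~ odd z, y < z & z' < z], (y == z) ==> ~~ odd z
    & ~~ ((y == z) && (z == z'))].
  move=> z0; apply: admissible_local => //; rewrite ltnNge; apply/negP => le_p.
  by rewrite /z nth_default in z0.
move: Hu He Hd; rewrite -/y -/y' -/z -/z' -/q.
move: (tri _ 0 q) (tri _ 0 p) => uq up.
move: (tri _ 0 q) (tri _ 0 p) => eq ep.
move: (tri _ 0 q) (tri _ 0 p) => dq dp.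
rewrite /des_ub /peak /bad oddN.
have -> : (N < y) = false by rewrite ltnNge ltnW.
have -> : (N < z) = false by rewrite ltnNge ltnW.
have -> : (z == N) = false by rewrite ltn_eqF.
have -> : (N == y) = false by rewrite gtn_eqF.
rewrite N0 ltnn eqxx leqnn yN zN (leqNgt N y) yN !andbF !andbT /=.
(* What is left depends only on the relative order of the four letters, their comparison with 0 and
   two parities. *)
clearbody y' y z z'; clear -zN loc_y loc_z.
move: (odd y) (odd z) loc_y loc_z => oy oz.
rewrite (ltnW zN); case: (posnP z) => [-> + _|_ + /(_ isT)[]].
  rewrite ltn0 leq0n; case: (ltngtP y 0) => //= _;
  case: (ltngtP y' y) => //= _; case: oy; case: b => //= *; split; lia.
case: (0 < y); case: (ltngtP y z) => //= _; case: (ltngtP z z') => //= _;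
case: (ltngtP y' y) => //= _; case: oy; case: oz; case: b => //= *; split; lia.
Qed.

(** * Recurrence for the joint distribution *)

Local Open Scope ring_scope.

Definition has_stats (p : seq nat) (i j l : int) : bool :=
  [&& (ubdes p)%:Z == i, (expk p)%:Z == j & (bddes p + desp p)%N%:Z == l].

Definition num_stats (W : seq (seq nat)) (i j l : int) : int :=
  \sum_(p <- W) (has_stats p i j l)%:R.

(** The five terms come from gaps of type U, R, L, D and of no type, in this order. The coefficients
    count such gaps in [p], and the shifted arguments are the statistics that [p] must have. *)
Lemma sum_ins_stats (N : nat) (b : bool) (p : seq nat) (i j l : int) :
  (0 < N)%N -> all (ltn^~ N) p -> odd N = ~~ b -> admissible p ->
  let beta : int := b%:R in
  \sum_(0 <= k < (size p).+1) (has_stats (ins (nseq b.+1 N) k p) i j l)%:R =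
  (i + 1 - beta) * (has_stats p (i + 1 - beta) (j - 1) l)%:R
  + j * (has_stats p (i - beta) j l)%:R
  + j * (has_stats p (i - beta) j (l - 1))%:R
  + (l + 1) * (has_stats p (i - beta) (j - 1) (l + 1))%:R
  + ((size p)%:Z + 1 - (i - beta) - 2 * (j - 1) - l)
    * (has_stats p (i - beta) (j - 1) l)%:R :> int.
Proof.
move=> N0 ltN oddN adm beta.
pose gap (Q : nat -> nat -> nat -> bool) k : int :=
  (Q (nth 0 [:: 0, 0 & p] k) (nth 0 (0 :: p) k) (nth 0 p k))%:R.
pose gapr (Q : nat -> nat -> nat -> bool) k : int :=
  (Q (nth 0 (0 :: p) k) (nth 0 p k) (nth 0 p k.+1))%:R.
have sum_gap Q : (forall a c, Q a 0 c = false) ->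
    \sum_(0 <= k < (size p).+1) gap Q k = (tri Q 0 p)%:R.
  by move=> Q0; rewrite -(sum_gaps_left Q p Q0) natr_sum.
have sum_gapr Q : (forall a c, Q a 0 c = false) ->
    \sum_(0 <= k < (size p).+1) gapr Q k = (tri Q 0 p)%:R.
  by move=> Q0; rewrite -(sum_gaps_right Q p Q0) natr_sum.
have pos_p : all (ltn 0) p by apply/allP => x /(proj2 adm)[].
transitivity (\sum_(0 <= k < (size p).+1)
   (gap des_ub k * (has_stats p (i + 1 - beta) (j - 1) l)%:R
   + gap peak k * (has_stats p (i - beta) j l)%:R
   + gapr peak k * (has_stats p (i - beta) j (l - 1))%:R
   + gap bad k * (has_stats p (i - beta) (j - 1) (l + 1))%:R
   + (1 - gap des_ub k - gap peak k - gapr peak k - gap bad k)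
    * (has_stats p (i - beta) (j - 1) l)%:R)).
  apply: eq_big_nat => k /=; rewrite ltnS => le_k; rewrite /gap /gapr.
  have := stat_ins _ _ _ _ N0 ltN oddN adm le_k.
  rewrite /= /has_stats /beta.
  move: (ubdes _) (expk _) (bddes _ + _)%N => u' e' d'.
  move: (ubdes _) (expk _) (bddes _ + _)%N => u e d.
  case: (des_ub _ _ _); case: (peak _ _ _); case: (peak _ _ _);
  case: (bad _ _ _) => /= -[Hu He Hd] // _;
  rewrite ?(mulr0n, mulr1n, mul0r, subr0, add0r, addr0, subrr) ?mul1r;
  congr (_ *+ _); congr nat_of_bool; congr andb; last congr andb;
  case: (b) Hu => Hu; lia.
rewrite !big_split /= -!mulr_suml !sumrB !sum_gap // !sum_gapr //.
rewrite -ubdes_tri -expk_tri -bddes_desp_tri // /has_stats.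
rewrite big_const_nat subn0 iter_addr_0 !natz.
(* The gap counts of [p] may be replaced by their values in [i], [j], [l] wherever the indicator is
   nonzero. *)
have eq_ind (x y : int) (c : bool) : (c -> x = y) -> x * c = y * c.
  by case: c => [-> //|_]; rewrite !mulr0.
by do 4?congr (_ + _); apply: eq_ind => /and3P[/eqP ? /eqP ? /eqP ?]; lia.
Qed.

Lemma num_stats_ins (N : nat) (b : bool) (s : seq nat) (i j l : int) :
  (0 < N)%N -> all (ltn^~ N) s -> odd N = ~~ b ->
  (forall p, p \in JS_perms s -> admissible p) ->
  let beta : int := b%:R in let W := JS_perms s in
  num_stats (JS_perms (nseq b.+1 N ++ s)) i j l =
  (i + 1 - beta) * num_stats W (i + 1 - beta) (j - 1) l
  + j * num_stats W (i - beta) j l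
  + j * num_stats W (i - beta) j (l - 1)
  + (l + 1) * num_stats W (i - beta) (j - 1) (l + 1)
  + ((size s)%:Z + 1 - (i - beta) - 2 * (j - 1) - l)
    * num_stats W (i - beta) (j - 1) l.
Proof.
move=> N0 ltN oddN adm beta W.
rewrite /num_stats (perm_big _ (JS_perms_ins _ _ _ ltN oddN)) big_allpairs_dep.
rewrite !mulr_sumr -!big_split -/W.
apply: eq_big_seq => p pW; have [_ eq_p] := JS_permsP _ _ pW.
have ltp : all (ltn^~ N) p by rewrite (perm_all _ eq_p).
have := sum_ins_stats N b p i j l N0 ltp oddN (adm _ pW).
by rewrite /index_iota subn0 (perm_size eq_p).
Qed.

(** * Solving the recurrence by binomial coefficients *)

(* Vanishing outside nonnegative arguments makes [binz_neighbours] hold for all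
   integers. *)
Definition binz (K l : int) : int :=
  match K, l with Posz k, Posz m => 'C(k, m)%:Z | _, _ => 0 end.

(** For [K = 0] and [l = 0] the sides would be 1 and 0. *)
Lemma binz_pascal (K l : int) :
  K <> 0 -> binz K l = binz (K - 1) l + binz (K - 1) (l - 1).
Proof.
case: K => [[|k]|k] // _; have ->: k.+1%:Z - 1 = k by lia.
case: l => [[|m]|m] //; first by rewrite /= !bin0.
by have -> : m.+1%:Z - 1 = m by lia; rewrite /= binS PoszD.
Qed.

(** Both summands equal [(K + 1) * binz K l]. They are the contributions of D gaps and of gaps
    without a type. *)
Lemma binz_neighbours (K l : int) :
  (l + 1) * binz (K + 1) (l + 1) + (K + 1 - l) * binz (K + 1) l =
  2 * (K + 1) * binz K l.
Proof.
case: K => [k|[|k]]; last first.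
- have -> : Negz k.+1 + 1 = Negz k by lia.
  by rewrite /= !mulr0 addr0.
(* For [K = -1] the left side involves binomials of 0, nonzero only at lower index 0, where the
   coefficient vanishes. *)
- have binz0 x : x * binz 0 x = 0.
    by case: x => [[|x]|x]; rewrite ?mul0r //= mulr0.
  have -> : Negz O + 1 = 0 by lia.
  by rewrite binz0 sub0r mulNr binz0 oppr0 addr0 mulr0.
have -> : k%:Z + 1 = k.+1 by lia.
case: l => [m|[|m]]; last first.
- have -> : Negz m.+1 + 1 = Negz m by lia.
  by rewrite /= !mulr0 addr0.
- have -> : Negz O + 1 = 0 by lia.
  by rewrite /= mul0r !mulr0 addr0.
have -> : m%:Z + 1 = m.+1 by lia.
have /= := mul_bin_diag k.+1 m; have /= := mul_bin_down k.+1 m.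
(* [mul_bin_down] contains the truncated difference [k.+1 - m]; beyond its range all three binomials
   are 0. *)
have [le_mk | lt_km] := leqP m k.+1; last first.
  by rewrite /= !bin_small //; lia.
by move: 'C(k, m) 'C(k.+1, m) 'C(k.+1, m.+1) => x y z; nia.
Qed.

(** The generating polynomial is the sum of [f i j] x^i y^j (1+z)^(m+1-i-2j). The second clause
    fixes [f] where [binz] vanishes identically and the first says nothing about it. *)
Definition gamma_dist (m : nat) (W : seq (seq nat)) (f : int -> int -> int) :=
  (forall i j l, num_stats W i j l = f i j * binz (m%:Z + 1 - i - 2 * j) l) /\
  (forall i j, m%:Z + 1 - i - 2 * j < 0 -> f i j = 0).

Lemma gamma_dist_perm (m : nat) (W W' : seq (seq nat)) (f : int -> int -> int) :
  perm_eq W W' -> gamma_dist m W f -> gamma_dist m W' f.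
Proof.
by move=> eqW [fW f0]; split=> // i j l; rewrite -fW /num_stats (perm_big _ eqW).
Qed.

(** With [K] the new upper index, U gaps already carry [binz K l], R and L gaps combine by Pascal's
    rule from [K - 1], and D and untyped gaps combine by [binz_neighbours] from [K + 1]. *)
Lemma gamma_dist_ins (N : nat) (b : bool) (s : seq nat)
    (f f' : int -> int -> int) :
  (0 < N)%N -> all (ltn^~ N) s -> odd N = ~~ b ->
  (forall p, p \in JS_perms s -> admissible p) ->
  let beta : int := b%:R in
  (forall i j, f' i j =
     (i + 1 - beta) * f (i + 1 - beta) (j - 1) + j * f (i - beta) j
     + 2 * ((size s)%:Z + 3 + beta - i - 2 * j) * f (i - beta) (j - 1)) ->
  gamma_dist (size s) (JS_perms s) f ->
  gamma_dist (b.+1 + size s) (JS_perms (nseq b.+1 N ++ s)) f'.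
Proof.
move=> N0 ltN oddN adm beta f'E [fW f0].
have betaE : beta = b by rewrite /beta natz.
split=> [i j l | i j K0]; last first.
  rewrite f'E (f0 (i + 1 - beta)) ?(f0 (i - beta) j) ?mulr0; [|lia..].
  (* This coefficient is the upper index of [f (i - beta) (j - 1)]: it is at most 0, and [f]
     vanishes if it is negative. *)
  have [K1|] := eqVneq ((size s)%:Z + 3 + beta - i - 2 * j) 0.
    by rewrite K1 mulr0 mul0r.
  by move=> K1; rewrite f0 ?mulr0 //; lia.
rewrite num_stats_ins // !fW -/beta f'E.
set K := (b.+1 + size s)%N%:Z + 1 - i - 2 * j.
have -> : (size s)%:Z + 1 - (i + 1 - beta) - 2 * (j - 1) = K by lia.
have -> : (size s)%:Z + 1 - (i - beta) - 2 * j = K - 1 by lia.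
have -> : (size s)%:Z + 1 - (i - beta) - 2 * (j - 1) = K + 1 by lia.
have -> : (size s)%:Z + 3 + beta - i - 2 * j = K + 1 by lia.
have H1 := binz_neighbours K l.
have H2 : f (i - beta) j * binz K l =
    f (i - beta) j * (binz (K - 1) l + binz (K - 1) (l - 1)).
  (* Where Pascal's rule fails, [f (i - beta) j] has upper index -1 and is 0. *)
  have [K0|/eqP/binz_pascal-> //] := eqVneq K 0.
  by rewrite f0 ?mul0r //; lia.
move: (f (i + 1 - beta) _) (f (i - beta) j) (f (i - beta) (j - 1)) H1 H2.
move=> x y z H1 H2.
transitivity ((i + 1 - beta) * x * binz K l + j * (y * binz K l)
              + z * (2 * (K + 1) * binz K l)); last by ring.
by rewrite -H1 H2; ring.
Qed.

(** * The two multisets and their letters *)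

Lemma M_S (n : nat) : M n.+1 = M n ++ [:: bar n.+1; unb n.+1; unb n.+1].
Proof. by rewrite /M -[X in iota _ X]addn1 iotaD map_cat flatten_cat add1n. Qed.

Lemma mem_M (n x : nat) : (x \in M n) = (0 < x <= n.*2)%N.
Proof.
elim: n => [|n IHn]; first by case: x.
by rewrite M_S mem_cat IHn !inE /bar /unb; lia.
Qed.

Lemma count_M (n x : nat) : x \in M n -> count_mem x (M n) = (~~ odd x).+1.
Proof.
elim: n => [//|n IHn]; rewrite M_S mem_cat count_cat.
have [xM _ | xM] := boolP (x \in M n).
  rewrite IHn //; move: xM; rewrite mem_M /= /bar /unb => le_x.
  by rewrite !gtn_eqF ?addn0 //; lia.
have barE : bar n.+1 = n.*2.+1 by [].
have unbE : unb n.+1 = n.*2.+2 by [].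
rewrite (count_memPn xM) !inE /= barE unbE.
by case/or3P => /eqP->; rewrite !eqxx /= odd_double /=; lia.
Qed.

Lemma perm_M (n : nat) :
  perm_eq (M n.+1) (nseq 2 (unb n.+1) ++ bar n.+1 :: M n).
Proof.
rewrite M_S perm_catC -[bar _ :: M n]cat1s catA perm_cat2r.
by apply: permEl; exact: (perm_catC [:: _] [:: _; _]).
Qed.

Lemma perm_MD (n : nat) : perm_eq (MD n.+1) (bar n.+1 :: M n).
Proof.
(* As [MD] is defined by removals, the two sides are compared after restoring the removed copies. *)
rewrite -(perm_cat2l (nseq 2 (unb n.+1))) -(permPr (perm_M n)) perm_sym /MD.
set u := unb _; have cnt : count_mem u (M n.+1) = 2.
  by rewrite count_M ?mem_M /u /unb ?odd_double //; lia.
have uM : u \in M n.+1 by rewrite -has_pred1 has_count cnt.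
have uM' : u \in rem u (M n.+1).
  by rewrite -has_pred1 has_count count_rem uM cnt /= eqxx.
by rewrite (permPl (perm_to_rem uM)) /= perm_cons perm_to_rem.
Qed.

Lemma size_M (n : nat) : size (M n) = (3 * n)%N.
Proof. by elim: n => [//|n IHn]; rewrite M_S size_cat IHn /=; lia. Qed.

Lemma admissible_M (n : nat) (p : seq nat) : p \in JSP n -> admissible p.
Proof.
case/JS_permsP => av eq_p; split=> // x; rewrite (perm_mem eq_p) => xM.
rewrite (permP eq_p) count_M //; split=> //.
by move: xM; rewrite mem_M => /andP[].
Qed.

Lemma admissible_MD (n : nat) (p : seq nat) : p \in JSPD n.+1 -> admissible p.
Proof.
case/JS_permsP => av eq_p; split=> // x.
have {}eq_p := perm_trans eq_p (perm_MD n).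
rewrite (perm_mem eq_p) (permP eq_p) inE /=.
have barE : bar n.+1 = n.*2.+1 by [].
have barM : bar n.+1 \notin M n by rewrite mem_M barE; lia.
have [-> _|neq_x /= xM] := eqVneq x (bar n.+1).
  by rewrite ?eqxx (count_memPn barM) barE /= odd_double.
rewrite count_M //; split=> //.
by move: xM; rewrite mem_M => /andP[].
Qed.

(** * Induction alternating between the two families *)

Lemma gamma_dist_JSPD1 (t : int -> int -> int) :
  t 0 1 = 1 -> (forall i j : int, (i, j) <> (0, 1) -> t i j = 0) ->
  gamma_dist 1 (JSPD 1) t.
Proof.
move=> t01 t0; split=> i j => [l|K0]; last by apply: t0 => -[]; lia.
have -> : JSPD 1 = [:: [:: 1%N]] by vm_compute.
rewrite /num_stats big_seq1.
have -> : has_stats [:: 1%N] i j l = [&& i == 0, j == 1 & l == 0].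
  have [u1 e1 b1] : [/\ ubdes [:: 1%N] = 0%N, expk [:: 1%N] = 1%N
    & (bddes [:: 1%N] + desp [:: 1%N] = 0)%N] by [].
  by rewrite /has_stats u1 e1 b1 (eq_sym _ i) (eq_sym _ j) (eq_sym _ l).
have [[-> ->] | ij] := eqVneq (i, j) (0, 1); last first.
  rewrite t0 ?mul0r; last exact/eqP.
  by move: ij; rewrite xpair_eqE; case: (i == 0); case: (j == 1).
(* The upper index is 1 + 1 - 0 - 2 = 0, so the binomial is the indicator of [l = 0]. *)
by rewrite t01 mul1r; case: l => [[|l]|l].
Qed.

(** At [l = 0] the binomial is 1 for a nonnegative upper index; for a negative one both sides are
    0. *)
Lemma gamma_dist_count (m : nat) (W : seq (seq nat)) (f : int -> int -> int)
    (i j : int) : gamma_dist m W f ->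
  f i j = (size [seq p <- W | [&& (ubdes p)%:Z == i, (expk p)%:Z == j,
                                  bddes p == 0%N & desp p == 0%N]])%:Z.
Proof.
move=> [fW f0]; transitivity (num_stats W i j 0).
  rewrite fW; case: (_ - _) (f0 i j) => [k _|k ->]; [|by rewrite mul0r|by []].
  by rewrite /= bin0 mulr1.
rewrite /num_stats size_filter -sum1_count -natz natr_sum [RHS]big_mkcond /=.
apply: eq_bigr => p _; rewrite /has_stats [_%:Z == 0]addn_eq0.
by do 4!case: (_ == _).
Qed.

Lemma gamma_dist_JSP (s t : nat -> int -> int -> int) (n : nat) :
  (forall i j : int, s n.+1 i j = i * t n.+1 i (j - 1) + j * t n.+1 (i - 1) j
     + 2 * (3 * n.+1%:Z + 2 - i - 2 * j) * t n.+1 (i - 1) (j - 1)) ->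
  gamma_dist (3 * n + 1) (JSPD n.+1) (t n.+1) ->
  gamma_dist (3 * n.+1) (JSP n.+1) (s n.+1).
Proof.
move=> s_rec tD.
have size_MD : size (MD n.+1) = (3 * n + 1)%N.
  by rewrite (perm_size (perm_MD n)) /= size_M addn1.
have eqM : perm_eq (nseq 2 (unb n.+1) ++ MD n.+1) (M n.+1).
  by rewrite perm_sym (permPl (perm_M n)) perm_cat2l perm_sym perm_MD.
apply: gamma_dist_perm (JS_perms_eq _ _ eqM) _.
have -> : (3 * n.+1 = true.+1 + size (MD n.+1))%N by rewrite size_MD /=; lia.
apply: (gamma_dist_ins _ true _ (t n.+1)).
- by rewrite /unb; lia.
- rewrite (perm_all _ (perm_MD n)) /=; apply/andP; split.
    by rewrite /bar /unb; lia.
  by apply/allP => x; rewrite mem_M /unb /=; lia.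
- by rewrite /unb odd_double.
- exact: admissible_MD.
(* Here [beta] is 1, and (3n + 1) + 3 + 1 = 3(n + 1) + 2. *)
- move=> i j; rewrite s_rec size_MD.
  have -> : i + 1 - 1%:R = i by lia.
  by congr (_ + _ * _); lia.
- by rewrite size_MD.
Qed.

Lemma gamma_dist_JSPD (s t : nat -> int -> int -> int) (n : nat) :
  (forall i j : int, t n.+1 i j = (i + 1) * s n (i + 1) (j - 1) + j * s n i j
     + 2 * (3 * n%:Z + 3 - i - 2 * j) * s n i (j - 1)) ->
  gamma_dist (3 * n) (JSP n) (s n) ->
  gamma_dist (3 * n + 1) (JSPD n.+1) (t n.+1).
Proof.
move=> t_rec sD.
have eqM : perm_eq (nseq 1 (bar n.+1) ++ M n) (MD n.+1).
  by rewrite perm_sym perm_MD.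
apply: gamma_dist_perm (JS_perms_eq _ _ eqM) _.
have -> : (3 * n + 1 = false.+1 + size (M n))%N by rewrite size_M /=; lia.
apply: (gamma_dist_ins _ false _ (s n)).
- by rewrite /bar; lia.
- by apply/allP => x; rewrite mem_M /bar /=; lia.
- by rewrite /bar doubleS /= odd_double.
- exact: admissible_M.
- move=> i j; rewrite t_rec size_M !subr0.
  by congr (_ + _ * _); lia.
- by rewrite size_M.
Qed.

Theorem theorem16
  (s t : nat -> int -> int -> int)
  (t1_01 : t 1%N 0 1 = 1)
  (t1_other : forall i j : int, (i, j) <> (0, 1) -> t 1%N i j = 0)
  (s_rec : forall (n : nat) (i j : int), (1 <= n)%N ->
     s n i j = i * t n i (j - 1) + j * t n (i - 1) j
               + 2 * (3 * n%:Z + 2 - i - 2 * j) * t n (i - 1) (j - 1))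
  (t_rec : forall (n : nat) (i j : int), (1 <= n)%N ->
     t n.+1 i j = (i + 1) * s n (i + 1) (j - 1) + j * s n i j
               + 2 * (3 * n%:Z + 3 - i - 2 * j) * s n i (j - 1))
  (n : nat) (hn : (1 <= n)%N) (i j : int) :
  s n i j = (size [seq p <- JSP n | [&& (ubdes p)%:Z == i, (expk p)%:Z == j,
                                       bddes p == 0%N & desp p == 0%N]])%:Z
  /\
  t n i j = (size [seq p <- JSPD n | [&& (ubdes p)%:Z == i, (expk p)%:Z == j,
                                        bddes p == 0%N & desp p == 0%N]])%:Z.
Proof.
case: n hn => // n _.
have JSP_JSPD k : gamma_dist (3 * k + 1) (JSPD k.+1) (t k.+1) ->
    gamma_dist (3 * k.+1) (JSP k.+1) (s k.+1).
  by apply: (gamma_dist_JSP s t) => ? ?; apply: s_rec.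
suff tD : gamma_dist (3 * n + 1) (JSPD n.+1) (t n.+1).
  by split; apply: gamma_dist_count; [apply: JSP_JSPD | apply: tD].
elim: n => [|n /JSP_JSPD sD]; first exact: gamma_dist_JSPD1.
by apply: gamma_dist_JSPD sD => ? ?; apply: t_rec.
Qed.
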